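(* Let $\{\mathbb{M}(t)\}_{t\ge0}$ be a GCP with rates $\lambda_1,\dots,\lambda_k\ge0$, $\Lambda=\sum_{j=1}^k\lambda_j>0$, and $\mathbb{M}_A(t)=\frac1t\int_0^t\mathbb{M}(s)\,ds$. Let $\{N(t)\}_{t\ge0}$ be a Poisson process with rate $\Lambda$ and $X_1,X_2,\dots$ i.i.d., independent of $N$, with density $f(x)=\sum_{j=1}^k\frac{\lambda_j}{\Lambda}\cdot\frac1j\mathbf{1}_{[0,j]}(x)$ (a mixture, with weights $\lambda_j/\Lambda$, of the uniform distributions on $[0,j]$). Then for every $t>0$, $\mathbb{M}_A(t)\overset{d}{=}\sum_{i=1}^{N(t)}X_i$.
   Context: A generalized counting process (GCP) with rates $\lambda_1,\dots,\lambda_k\ge0$ is a Lévy process $\{\mathbb{M}(t)\}_{t\ge0}$ with $\mathbb{M}(0)=0$ and $\mathbb{E}[u^{\mathbb{M}(t)}]=\exp\left(t\sum_{j=1}^k\lambda_j(u^j-1)\right)$. *)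

(* Defs.v *)
From HB Require Import structures.
From mathcomp Require Import all_boot all_order all_algebra.
From mathcomp Require Import all_classical all_reals all_analysis.
Set Implicit Arguments. Unset Strict Implicit. Unset Printing Implicit Defensive.
Import Order.TTheory GRing.Theory Num.Theory.
Import numFieldNormedType.Exports.
Local Open Scope classical_set_scope.
Local Open Scope ring_scope.

(* real-valued probability of an event (P is a probability, hence finite) *)
Definition prob {R : realType} {d : measure_display} {T : measurableType d}
  (P : probability T R) (A : set T) : R := fine (P A).

Definition proc_R {R : realType} {T : Type} (M : R -> T -> nat) (t : R) : T -> R :=
  fun w => (M t w)%:R.

Definition is_levy_process {R : realType} {d : measure_display}
  {T : measurableType d} (P : probability T R) (M : R -> T -> nat) : Prop :=
  [/\ (forall w, M 0 w = 0%N),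
      (forall t, 0 <= t -> measurable_fun setT (proc_R M t)),
      (forall w t, 0 <= t ->
         (fun s => proc_R M s w) @ at_right t --> proc_R M t w) /\
      (forall w t, 0 < t -> cvg ((fun s => proc_R M s w) @ at_left t)),
      (forall (n : nat) (ts : nat -> R) (B : nat -> set R),
         0 <= ts 0%N -> (forall i, ts i <= ts i.+1) ->
         (forall i, measurable (B i)) ->
         prob P (\bigcap_(i in `I_n)
                   [set w | proc_R M (ts i.+1) w - proc_R M (ts i) w \in B i])
         = \prod_(i < n)
             prob P [set w | proc_R M (ts i.+1) w - proc_R M (ts i) w \in B i]) &
      (forall s t (B : set R), 0 <= s -> 0 <= t -> measurable B ->
         prob P [set w | proc_R M (s + t) w - proc_R M s w \in B]
         = prob P [set w | proc_R M t w \in B])].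

Definition is_GCP {R : realType} {d : measure_display} {T : measurableType d}
  (P : probability T R) (k : nat) (lam : nat -> R) (M : R -> T -> nat) : Prop :=
  [/\ (forall j, (1 <= j <= k)%N -> 0 <= lam j),
      is_levy_process P M &
      (forall t u, 0 <= t -> -1 <= u <= 1 ->
         (\int[P]_w ((u ^+ M t w)%:E) = (expR (t * \sum_(1 <= j < k.+1)
              lam j * (u ^+ j - 1)))%:E)%E)].

Definition is_poisson_process {R : realType} {d : measure_display}
  {T : measurableType d} (P : probability T R) (Lam : R) (N : R -> T -> nat) :=
  is_GCP P 1 (fun _ => Lam) N.

Definition time_avg {R : realType} {T : Type} (M : R -> T -> nat) (t : R) : T -> R :=
  fun w => t^-1 * Rintegral lebesgue_measure `[0, t] (fun s => (M s w)%:R).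

Definition mix_density {R : realType} (k : nat) (lam : nat -> R) (x : R) : R :=
  let Lam := \sum_(1 <= j < k.+1) lam j in
  \sum_(1 <= j < k.+1) (lam j / Lam) * (j%:R)^-1 *
      (if (0 <= x) && (x <= j%:R) then 1 else 0).

(* Main.v *)
Require Import Defs.
From HB Require Import structures.
From mathcomp Require Import all_boot all_order all_algebra.
From mathcomp Require Import all_classical all_reals all_analysis measurable_realfun.
From mathcomp Require Import ring lra.
Import Order.TTheory GRing.Theory Num.Theory.
Import numFieldNormedType.Exports.
Local Open Scope classical_set_scope.
Local Open Scope ring_scope.

(** Both sides are nonnegative, so it suffices to compare Laplace transforms.

    The time average is the limit of the Riemann means
    [(1/n) sum_(i <= n) M (t i / n)]; Abel summation writes such a mean as a
    combination of the independent increments [M (t (i+1) / n) - M (t i / n)]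
    with weights [(n - i) / n], so its Laplace transform at [s] is
    [exp (t sum_j lam_j (a_n - 1))], where [a_n = (1/n) sum_i e^(- s j i / n)]
    is itself a Riemann mean, of [x |-> e^(- s x)] over [0, j].  In the limit
    [a_n] becomes the Laplace transform of the uniform law on [0, j].
    Conditioning on [N t] gives [E (phi ^ N t)] for the compound sum, with [phi]
    the Laplace transform of the mixture, and the generating function of [N t]
    yields the same value.

    Laplace transforms determine laws on [0, +oo[: the functions
    [y |-> (1 - 2 ^ (- n y / c)) ^ (n 2 ^ n)] are combinations of exponentials
    with values in [0, 1] and converge pointwise to the indicator of
    []c, +oo[. *)

(** * Integrals determined by weighted laws, and products of independent variables *)

Section weighted_law.
Context {R : realType} (dY : measure_display) (Y : measurableType dY).
Import HBNNSimple.

(** Monotone convergence along the simple approximations of [f]. These depend on [f] alone, so [X]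
    and [G] enter the right-hand side only through integrals of [G] over preimages of level sets. *)
Lemma integral_weighted_approx (d : measure_display) (T : measurableType d)
  (mu : {measure set T -> \bar R}) (G : T -> R) (X : T -> Y) (f : Y -> R)
  (mf : measurable_fun setT (EFin \o f)) :
  measurable_fun setT G -> (forall w, 0 <= G w) ->
  measurable_fun setT X -> (forall x, 0 <= f x) ->
  (\int[mu]_w (G w * f (X w))%:E =
   limn (fun n => \sum_(y \in range (nnsfun_approx measurableT mf n))
     y%:E * \int[mu]_w (G w * \1_(nnsfun_approx measurableT mf n @^-1` [set y])
                               (X w))%:E))%E.
Proof.
move=> mG G0 mX f0.
set g := nnsfun_approx measurableT mf.
have mgX n : measurable_fun setT (fun w => g n (X w)).
  exact: (measurableT_comp (measurable_funP (g n))).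
transitivity (limn (fun n => \int[mu]_w (G w * g n (X w))%:E))%E.
  rewrite -monotone_convergence//; first last.
  - by move=> w _ m n mn; rewrite lee_fin ler_wpM2l//; exact/lefP/nd_nnsfun_approx.
  - by move=> n w _; rewrite lee_fin mulr_ge0.
  - by move=> n; apply/measurable_EFinP; exact: measurable_funM.
  apply: eq_integral => w _; apply/esym/cvg_lim => //.
  under eq_fun do rewrite EFinM.
  rewrite EFinM; apply: cvgeZl => //.
  by apply: (@cvg_nnsfun_approx _ _ _ _ measurableT _ mf) => // x _; rewrite lee_fin.
apply: congr_lim; apply/funext => n.
have E w : ((G w * g n (X w))%:E = \sum_(y \in range (g n))
    (y * (G w * \1_(g n @^-1` [set y]) (X w)))%:E)%E.
  rewrite fimfunE fsumEFin// mulr_fsumr.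
  by congr EFin; apply: eq_fsbigr => y _; rewrite mulrCA.
under eq_integral do rewrite E.
have mI y : measurable_fun setT (fun w => G w * \1_(g n @^-1` [set y]) (X w)).
  apply: measurable_funM => //.
  by apply: measurableT_comp => //; exact: measurable_indic.
have I0 y w : 0 <= y * (G w * \1_(g n @^-1` [set y]) (X w)).
  have [y0|y0] := leP 0 y; first by rewrite !mulr_ge0.
  by rewrite preimage_nnfun0// indic0 !mulr0.
rewrite ge0_integral_fsum//.
- apply: eq_fsbigr => y; rewrite inE => -[x _ <-].
  under eq_integral do rewrite EFinM.
  rewrite ge0_integralZl_EFin//.
  + by move=> w _; rewrite lee_fin mulr_ge0.
  + exact/measurable_EFinP.
- by move=> y; apply/measurable_EFinP; exact: measurable_funM.
- by move=> y w _; rewrite lee_fin.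
Qed.

(** Both integrals are limits of the same expression in the weighted measures of level sets. The
    weights serve twice: to freeze the other coordinates of a product, and to carry a density. *)
Lemma eq_weighted_law_integral
  (d d' : measure_display) (T : measurableType d) (T' : measurableType d')
  (mu : {measure set T -> \bar R}) (mu' : {measure set T' -> \bar R})
  (G : T -> R) (G' : T' -> R) (X : T -> Y) (X' : T' -> Y) (f : Y -> R) :
  measurable_fun setT G -> (forall w, 0 <= G w) ->
  measurable_fun setT G' -> (forall w, 0 <= G' w) ->
  measurable_fun setT X -> measurable_fun setT X' ->
  (forall B, measurable B -> (\int[mu]_w (G w * \1_B (X w))%:E =
                              \int[mu']_w (G' w * \1_B (X' w))%:E)%E) ->
  measurable_fun setT f -> (forall x, 0 <= f x) ->
  (\int[mu]_w (G w * f (X w))%:E = \int[mu']_w (G' w * f (X' w))%:E)%E.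
Proof.
move=> mG G0 mG' G0' mX mX' GG' /measurable_EFinP mf f0.
rewrite !(integral_weighted_approx _ _ _ _ _ _ mf)//.
apply: congr_lim; apply/funext => n; apply: eq_fsbigr => y _.
by rewrite GG'.
Qed.

Lemma eq_law_integral
  (d d' : measure_display) (T : measurableType d) (T' : measurableType d')
  (mu : {measure set T -> \bar R}) (mu' : {measure set T' -> \bar R})
  (X : T -> Y) (X' : T' -> Y) (f : Y -> R) :
  measurable_fun setT X -> measurable_fun setT X' ->
  (forall B, measurable B -> mu (X @^-1` B) = mu' (X' @^-1` B)) ->
  measurable_fun setT f -> (forall x, 0 <= f x) ->
  (\int[mu]_w (f (X w))%:E = \int[mu']_w (f (X' w))%:E)%E.
Proof.
move=> mX mX' XX' mf f0.
have I (e : measure_display) (U : measurableType e)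
    (nu : {measure set U -> \bar R}) (Z : U -> Y) B :
    measurable_fun setT Z -> measurable B ->
    (\int[nu]_w (1 * \1_B (Z w))%:E = nu (Z @^-1` B))%E.
  move=> mZ mB; rewrite -[Z @^-1` B]setIT -integral_indic//; last first.
    by rewrite -[_ @^-1` _]setTI; exact: mZ.
  by apply: eq_integral => w _; rewrite mul1r.
transitivity (\int[mu]_w (1 * f (X w))%:E)%E.
  by apply: eq_integral => w _; rewrite mul1r.
transitivity (\int[mu']_w (1 * f (X' w))%:E)%E; last first.
  by apply: eq_integral => w _; rewrite mul1r.
apply: (@eq_weighted_law_integral _ _ _ _ mu mu' (cst 1) (cst 1)) => // B mB.
by rewrite !I// XX'.
Qed.

(* Fubini-free: indicators are exchanged for functions one coordinate at a
   time, the other coordinates being frozen into the weight [G]. *)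
Lemma independent_integral_prod (d : measure_display) (T : measurableType d)
  (P : probability T R) (n : nat) (X : nat -> T -> Y) (h : nat -> Y -> R)
  (c : nat -> R) :
  (forall i, measurable_fun setT (X i)) ->
  (forall B : nat -> set Y, (forall i, measurable (B i)) ->
    fine (P (\bigcap_(i in `I_n) (X i @^-1` B i))) =
    \prod_(i < n) fine (P (X i @^-1` B i))) ->
  (forall i, measurable_fun setT (h i)) -> (forall i y, 0 <= h i y) ->
  (forall i, \int[P]_w (h i (X i w))%:E = (c i)%:E)%E ->
  (\int[P]_w (\prod_(i < n) h i (X i w))%:E = (\prod_(i < n) c i)%:E)%E.
Proof.
move=> mX indep.
have mXB i B : measurable B -> measurable (X i @^-1` B).
  by move=> mB; rewrite -[_ @^-1` _]setTI; exact: mX.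
have IB i B : measurable B -> (\int[P]_w (\1_B (X i w))%:E = P (X i @^-1` B))%E.
  move=> mB; rewrite -[X i @^-1` B]setIT -integral_indic//; last exact: mXB.
(* Induction on the number [j] of leading coordinates whose function is arbitrary; all later ones
   carry indicators. *)
suff H j : (j <= n)%N -> forall (h : nat -> Y -> R) (c : nat -> R),
  (forall i, (j <= i)%N -> exists2 B, measurable B & h i = \1_B) ->
  (forall i, measurable_fun setT (h i)) -> (forall i y, 0 <= h i y) ->
  (forall i, \int[P]_w (h i (X i w))%:E = (c i)%:E)%E ->
  (\int[P]_w (\prod_(i < n) h i (X i w))%:E = (\prod_(i < n) c i)%:E)%E.
  move=> mh h0 hc.
  (* Indices beyond the product get the indicator of the whole space, so that [H] applies with
     [j = n]. *)
  pose h' i := if (i < n)%N then h i else \1_setT.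
  pose c' i := if (i < n)%N then c i else 1.
  transitivity (\int[P]_w (\prod_(i < n) h' i (X i w))%:E)%E.
    by apply: eq_integral => w _; under [in RHS]eq_bigr do rewrite /h' ltn_ord.
  have -> : \prod_(i < n) c i = \prod_(i < n) c' i.
    by under [in RHS]eq_bigr do rewrite /c' ltn_ord.
  apply: (H n (leqnn _)).
  - by move=> i ni; rewrite /h' ltnNge ni; exists setT.
  - by move=> i; rewrite /h'; case: ifPn => // _; exact: measurable_indic.
  - by move=> i y; rewrite /h'; case: ifPn.
  - move=> i; rewrite /h' /c'; case: ifPn => // _.
    by rewrite IB// preimage_setT probability_setT.
(* With indicators everywhere, the product is the indicator of an intersection and the claim is the
   assumed independence of events. *)
elim: j => [_ {}h {}c hB mh h0 hc|j IH jn {}h {}c hB mh h0 hc].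
  have /choice[B mhB] i : exists B, measurable B /\ h i = \1_B.
    by have [B] := hB i isT; exists B.
  have cE i : c i = fine (P (X i @^-1` B i)).
    have [mB hE] := mhB i.
    by rewrite -IB// -hE hc.
  under [in RHS]eq_bigr do rewrite cE.
  have mB i : measurable (B i) by have [] := mhB i.
  rewrite -indep// fineK; last first.
    by apply: fin_num_measure; apply: bigcap_measurableType => i _; exact: mXB.
  rewrite -[X in P X]setIT -integral_indic//; last first.
    by apply: bigcap_measurableType => i _; exact: mXB.
  apply: eq_integral => w _; congr EFin.
  rewrite indicE; have [wB|wB] := boolP (_ \in _).
    move: wB; rewrite inE => wB; apply: big1 => i _.
    by rewrite (mhB i).2 indicE mem_set//; exact: (wB i (ltn_ord i)).
  have [i]: exists i : 'I_n, X i w \notin B i.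
    apply: contrapT => H; move: wB; rewrite notin_setE; apply => i /= ilt.
    by apply: contrapT => Bi; apply: H; exists (Ordinal ilt); rewrite notin_setE.
  move=> iB; rewrite (bigD1 i)//= (mhB i).2 indicE (negbTE iB) mul0r//.
(* The random weight [G] may be traded for the constant [C] as soon as this is possible against
   every indicator of [X j]. *)
pose G w := \prod_(i < n | i != Ordinal jn) h i (X i w).
pose C := \prod_(i < n | i != Ordinal jn) c i.
have c0 i : 0 <= c i.
  by rewrite -lee_fin -hc; apply: integral_ge0 => w _; rewrite lee_fin.
rewrite (bigD1 (Ordinal jn))//= EFinM -hc -/C muleC.
transitivity (\int[P]_w (C * h j (X j w))%:E)%E; last first.
  under eq_integral do rewrite EFinM.
  rewrite ge0_integralZl_EFin//.
  - by move=> w _; rewrite lee_fin.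
  - by apply/measurable_EFinP; exact: measurableT_comp.
  - exact: prodr_ge0.
transitivity (\int[P]_w (G w * h j (X j w))%:E)%E.
  by apply: eq_integral => w _; rewrite (bigD1 (Ordinal jn))//= mulrC.
apply: (@eq_weighted_law_integral _ _ _ _ P P G (cst C) (X j) (X j) (h j)) => //.
- rewrite /G; under eq_fun do rewrite -big_filter.
  by apply: measurable_prod => i _; exact: measurableT_comp.
- by move=> w; exact: prodr_ge0.
- by move=> w; exact: prodr_ge0.
move=> B mB.
(* Putting an indicator at coordinate [j] leaves only [j] arbitrary coordinates, which is the
   induction hypothesis. *)
pose h' i := if i == j then \1_B else h i.
pose c' i := if i == j then fine (P (X j @^-1` B)) else c i.
transitivity (\int[P]_w (\prod_(i < n) h' i (X i w))%:E)%E.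
  apply: eq_integral => w _; rewrite [in RHS](bigD1 (Ordinal jn))//= mulrC.
  rewrite {1}/h' eqxx; congr (_ * _)%:E; apply: eq_bigr => i ij.
  by rewrite /h' ifN.
rewrite (IH (ltnW jn) h' c').
- rewrite (bigD1 (Ordinal jn))//= {1}/c' eqxx.
  under [RHS]eq_integral do rewrite EFinM.
  rewrite ge0_integralZl_EFin//; first last.
  + exact: prodr_ge0.
  + by apply/measurable_EFinP; apply: measurableT_comp => //; exact: measurable_indic.
  rewrite IB// EFinM fineK ?fin_num_measure//; last exact: mXB.
  rewrite muleC; congr (_ * _)%E; congr EFin; apply: eq_bigr => i ij.
  by rewrite /c' ifN.
- move=> i ji; rewrite /h'; case: eqVneq => ij; first by exists B.
  by apply: hB; rewrite ltn_neqAle eq_sym ij.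
- by move=> i; rewrite /h'; case: ifPn => // _; exact: measurable_indic.
- by move=> i y; rewrite /h'; case: ifPn.
- move=> i; rewrite /h' /c'; case: eqVneq => [->|//].
  by rewrite IB// fineK ?fin_num_measure//; exact: mXB.
Qed.
End weighted_law.

(** * Laplace transforms determine laws on the nonnegative half-line *)

Section laplace_uniqueness.
Context {R : realType}.

Lemma measurable_expRN (d : measure_display) (T : measurableType d)
  (a : R) (X : T -> R) : measurable_fun setT X ->
  measurable_fun setT (fun w => expR (- (a * X w))).
Proof.
move=> mX; apply: measurableT_comp => //; apply: measurableT_comp => //.
exact: measurable_funM.
Qed.

Lemma bernoulli_ge (a : R) (n : nat) : 0 <= a -> 1 + n%:R * a <= (1 + a) ^+ n.
Proof.
move=> a0; elim: n => [|n IH]; first by rewrite expr0 mul0r addr0.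
rewrite exprS (le_trans _ (ler_wpM2l _ IH)) ?addr_ge0//.
have H : 0 <= n%:R * a * a by rewrite !mulr_ge0.
by rewrite -natr1; lra.
Qed.

Lemma bernoulli_le (a : R) (n : nat) :
  0 <= a <= 1 -> 1 - n%:R * a <= (1 - a) ^+ n.
Proof.
move=> /andP[a0 a1]; elim: n => [|n IH]; first by rewrite expr0 mul0r subr0.
rewrite exprS (le_trans _ (ler_wpM2l _ IH)) ?subr_ge0//.
have H : 0 <= n%:R * a * a by rewrite !mulr_ge0.
by rewrite -natr1; lra.
Qed.

(** With [y] the square root of [x], the term is [(n * y ^ n) * y ^ n]; Bernoulli's inequality for
    [1 / y = 1 + a] bounds the first factor by [1 / a], and the second tends to 0. *)
Lemma cvg_natmul_expr (x : R) : 0 <= x < 1 ->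
  (fun n => n%:R * x ^+ n) @ \oo --> (0 : R).
Proof.
move=> /andP[x0 x1]; have [->|xN0] := eqVneq x 0.
  apply: cvg_near_cst; near=> n.
  rewrite expr0n gtn_eqF ?mulr0//; near: n; exact: nbhs_infty_gt.
pose y := Num.sqrt x.
have y0 : 0 < y by rewrite sqrtr_gt0 lt_neqAle eq_sym xN0.
have y1 : y < 1 by rewrite -[ltRHS]sqrtr1 ltr_sqrt.
pose a := y^-1 - 1.
have a0 : 0 < a by rewrite subr_gt0 invf_gt1.
have B n : n%:R * y ^+ n <= a^-1.
  have := bernoulli_ge a n (ltW a0).
  rewrite addrCA subrr addr0 exprVn => H.
  rewrite -ler_pdivlMr ?exprn_gt0// ler_pdivlMl//.
  by apply: le_trans H; rewrite mulrC lerDr.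
apply: (@squeeze_cvgr _ _ _ _ (cst 0) (fun n => a^-1 * y ^+ n)).
- apply: nearW => n; rewrite mulr_ge0 ?exprn_ge0//=.
  rewrite -(sqr_sqrtr x0) -/y -exprM mulnC exprM expr2 mulrA.
  by rewrite ler_wpM2r// exprn_ge0// ltW.
- exact: cvg_cst.
- rewrite -[X in _ --> X](mulr0 a^-1); apply: cvgMl_tmp; apply: cvg_expr.
  by rewrite gtr0_norm.
Unshelve. all: by end_near. Qed.

(** Below 1/2, Bernoulli gives the lower bound [1 - n * (2 * q) ^ n], which tends to 1. From 1/2 on,
    [(1 - q ^ n) * (1 + q ^ n) <= 1], and the same power of [1 + q ^ n] is at least [n + 1]. *)
Lemma cvg_step_expr (q : R) : 0 <= q <= 1 ->
  (fun n => (1 - q ^+ n) ^+ (n * 2 ^ n)) @ \oo -->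
  (if q < 2^-1 then 1 else 0 : R).
Proof.
move=> /andP[q0 q1].
have qn0 n : 0 <= q ^+ n <= 1 by rewrite exprn_ge0//= exprn_ile1.
have sn0 n : 0 <= 1 - q ^+ n <= 1 by have := qn0 n; lra.
case: ifPn => [q2|]; last rewrite -leNgt => q2.
- apply: (@squeeze_cvgr _ _ _ _ (fun n => 1 - n%:R * (2 * q) ^+ n) (cst 1)).
  + apply: nearW => n; have /andP[s0 s1] := sn0 n.
    rewrite exprn_ile1//= andbT.
    rewrite (le_trans _ (bernoulli_le _ _ (qn0 n)))// natrM natrX exprMn mulrA.
    by [].
  + rewrite -[X in _ --> X]subr0; apply: cvgB; first exact: cvg_cst.
    by apply: cvg_natmul_expr; lra.
  + exact: cvg_cst.
- apply: (@squeeze_cvgr _ _ _ _ (cst 0) (@harmonic R)).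
  + apply: nearW => n; have /andP[s0 s1] := sn0 n.
    rewrite exprn_ge0//= -[leRHS]mul1r ler_pdivlMr//.
    have /andP[Q0 Q1] := qn0 n.
    have H : n.+1%:R <= (1 + q ^+ n) ^+ (n * 2 ^ n).
      rewrite (le_trans _ (bernoulli_ge _ _ Q0))// natrM natrX -mulrA -exprMn.
      rewrite -natr1 addrC lerD2l ler_peMr// exprn_ege1//; lra.
    rewrite (le_trans (ler_wpM2l _ H)) ?exprn_ge0// -exprMn exprn_ile1//.
    * by rewrite mulr_ge0// addr_ge0.
    * have : 0 <= q ^+ n * q ^+ n by rewrite mulr_ge0.
      lra.
  + exact: cvg_cst.
  + exact: cvg_harmonic.
Qed.

(* The coefficients of [(1 - x) ^+ (n * 2 ^ n)]. *)
Definition laplace_coef (n i : nat) : R := (-1) ^+ i * 'C(n * 2 ^ n, i)%:R.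

(** Dominated convergence for the polynomials of [cvg_step_expr] in [q = expR (- (r * Y))], with
    [r = ln 2 / c]. Expanding the binomial turns each expectation into a combination of values of
    [L], so the tail depends on [L] alone. *)
Lemma laplace_tail (d : measure_display) (T : measurableType d)
  (P : probability T R) (Y : T -> R) (L : R -> R) :
  measurable_fun setT Y -> {ae P, forall w, 0 <= Y w} ->
  (forall s, 0 <= s -> (\int[P]_w (expR (- (s * Y w)))%:E = (L s)%:E)%E) ->
  forall c, 0 < c ->
  P (Y @^-1` `]c, +oo[) =
  limn (fun n => (\sum_(i < (n * 2 ^ n).+1)
    laplace_coef n i * L (i%:R * (n%:R * (ln 2 / c))))%:E).
Proof.
move=> mY Y0 YL c c0.
set r := ln 2 / c.
have r0 : 0 < r by rewrite divr_gt0// ln_gt0// ltr1n.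
have nr0 (i n : nat) : 0 <= i%:R * (n%:R * r) by rewrite mulr_ge0 // mulr_ge0 // ltW.
have mE s := measurable_expRN _ _ s _ mY.
pose f n w := (1 - expR (- (r * Y w)) ^+ n) ^+ (n * 2 ^ n).
have fE n w : f n w = \sum_(i < (n * 2 ^ n).+1)
    laplace_coef n i * expR (- (i%:R * (n%:R * r) * Y w)).
  rewrite /f exprBn; apply: eq_bigr => i _.
  rewrite expr1n mulr1 -mulr_natr /laplace_coef mulrAC; congr (_ * _).
  by rewrite -exprM -expRM_natl; congr expR; rewrite natrM; ring.
have fint n : (\int[P]_w (f n w)%:E = (\sum_(i < (n * 2 ^ n).+1)
    laplace_coef n i * L (i%:R * (n%:R * r)))%:E)%E.
  under eq_integral do rewrite fE -sumEFin.
  have intE (i : 'I_(n * 2 ^ n).+1) :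
      P.-integrable setT (fun w => (expR (- (i%:R * (n%:R * r) * Y w)))%:E).
    apply/integrableP; split; first exact/measurable_EFinP.
    by rewrite integral_fin_num_abs// YL.
  rewrite integral_sum//; last first.
    move=> i; under eq_fun do rewrite EFinM.
    exact: integrableZl.
  rewrite -sumEFin; apply: eq_bigr => i _.
  under eq_integral do rewrite EFinM.
  by rewrite integralZl// YL.
(* The choice of [r] places the threshold 1/2 exactly at [Y = c]; the strict inequality matches the
   open ray. *)
have YcE : Y @^-1` `]c, +oo[ = [set w | expR (- (r * Y w)) < 2^-1].
  apply/seteqP; split => w /=; rewrite in_itv/= andbT;
    rewrite -[2^-1]lnK ?posrE ?invr_gt0// ltr_expR lnV ?posrE// ltrN2;
    by rewrite -ltr_pdivrMl// /r invf_div divfK// gt_eqF// ln_gt0// ltr1n.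
have mYc : measurable (Y @^-1` `]c, +oo[).
  by rewrite -[_ @^-1` _]setTI; exact: mY.
have [//|||||_ _] := @dominated_convergence _ _ _ P setT measurableT
  (fun n w => (f n w)%:E) (EFin \o \1_(Y @^-1` `]c, +oo[)) (cst 1)%E.
- move=> n; apply/measurable_EFinP; rewrite /f.
  apply: measurable_funX; apply: measurable_funB => //.
  by apply: measurable_funX.
- by apply/measurable_EFinP; exact: measurable_indic.
- apply: filterS Y0 => w Yw _; apply: cvg_EFin; first exact: nearW.
  rewrite indicE YcE.
  have -> : (w \in [set w | expR (- (r * Y w)) < 2^-1])%:R =
      (if expR (- (r * Y w)) < 2^-1 then 1 else 0 : R).
    by case: ifPn => H; [rewrite mem_set|rewrite memNset//; exact/negP].
  apply: cvg_step_expr.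
  by rewrite expR_ge0/= expR_le1 oppr_le0 mulr_ge0// ltW.
- exact: finite_measure_integrable_cst.
- apply: filterS Y0 => w Yw n _; rewrite /= lee_fin.
  have ? : 0 <= expR (- (r * Y w)) ^+ n <= 1.
    rewrite exprn_ge0 ?expR_ge0//= exprn_ile1 ?expR_ge0//.
    by rewrite expR_le1 oppr_le0 mulr_ge0// ltW.
  rewrite ger0_norm ?exprn_ge0 ?exprn_ile1//; lra.
rewrite integral_indic// setIT => /cvg_lim <-//.
by apply: congr_lim; apply/funext => n /=; rewrite fint.
Qed.

(** Open upper rays are stable under intersection and generate the Borel sets, so equal tails
    suffice. For [c > 0] they come from [laplace_tail], for [c < 0] from nonnegativity, and for
    [c = 0] by a limit. *)
Lemma eq_laplace_law (d1 d2 : measure_display) (T1 : measurableType d1)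
  (T2 : measurableType d2) (P1 : probability T1 R) (P2 : probability T2 R)
  (Y : T1 -> R) (Z : T2 -> R) (L : R -> R) :
  measurable_fun setT Y -> measurable_fun setT Z ->
  {ae P1, forall w, 0 <= Y w} -> {ae P2, forall w, 0 <= Z w} ->
  (forall s, 0 <= s -> (\int[P1]_w (expR (- (s * Y w)))%:E = (L s)%:E)%E) ->
  (forall s, 0 <= s -> (\int[P2]_w (expR (- (s * Z w)))%:E = (L s)%:E)%E) ->
  forall B, measurable B -> P1 (Y @^-1` B) = P2 (Z @^-1` B).
Proof.
move=> mY mZ Y0 Z0 YL ZL.
pose Y' : {mfun T1 >-> R} := HB.pack Y (isMeasurableFun.Build _ _ _ _ Y mY).
pose Z' : {mfun T2 >-> R} := HB.pack Z (isMeasurableFun.Build _ _ _ _ Z mZ).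
have tail_neg (d : measure_display) (T : measurableType d)
    (P : probability T R) (X : T -> R) c : c < 0 -> measurable_fun setT X ->
    {ae P, forall w, 0 <= X w} -> P (X @^-1` `]c, +oo[) = 1%E.
  move=> c0 mX X0.
  have mXc : measurable (X @^-1` `]c, +oo[).
    by rewrite -[_ @^-1` _]setTI; exact: mX.
  apply/eqP; rewrite -[X in P X]setCK probability_setC; last exact: measurableC.
  suff -> : P (~` (X @^-1` `]c, +oo[)) = 0%E by rewrite sube0.
  apply/negligibleP; first exact: measurableC.
  apply: negligibleS X0 => w /=; rewrite in_itv/= andbT => /negP.
  by rewrite -leNgt => Xc; apply/negP; rewrite -ltNge; exact: le_lt_trans c0.
have tail_pos c : 0 < c -> P1 (Y @^-1` `]c, +oo[) = P2 (Z @^-1` `]c, +oo[).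
  by move=> c0; rewrite (laplace_tail _ _ _ Y L)// (laplace_tail _ _ _ Z L).
(* Continuity from below reaches the ray at 0, where [ln 2 / c] would make no sense. *)
have tail0 (d : measure_display) (T : measurableType d)
    (P : probability T R) (X : T -> R) : measurable_fun setT X ->
    P (X @^-1` `]n.+1%:R^-1, +oo[) @[n --> \oo] --> P (X @^-1` `]0, +oo[).
  move=> mX.
  have -> : X @^-1` `]0, +oo[ = \bigcup_n X @^-1` `]n.+1%:R^-1, +oo[.
    apply/seteqP; split => w /=; rewrite in_itv/= andbT.
      move=> Xw; exists (Num.truncn (X w)^-1) => //=; rewrite in_itv/= andbT.
      by rewrite invf_plt ?posrE// truncnS_gt.
    by move=> [n _] /=; rewrite in_itv/= andbT; apply: lt_trans; rewrite invr_gt0.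
  apply: nondecreasing_cvg_mu.
  - by move=> n; rewrite -[_ @^-1` _]setTI; exact: mX.
  - by apply: bigcup_measurable => n _; rewrite -[_ @^-1` _]setTI; exact: mX.
  - move=> m n mn; apply/subsetPset => w /=; rewrite !in_itv/= !andbT.
    by apply: le_lt_trans; rewrite lef_pV2 ?posrE// ler_nat.
move=> B mB.
apply: (@measure_unique _ R R (@RGenOInfty.G R)
  (fun k => `]- k%:R, +oo[%classic) _ _ _ _
  (distribution P1 Y') (distribution P2 Z')) => //.
- exact: RGenOInfty.measurableE.
- move=> _ _ [a ->] [b ->]; exists (Num.max a b).
  apply/seteqP; split => x /=; rewrite !in_itv/= !andbT gt_max.
    by move=> [-> ->].
  by move=> /andP[].
- by move=> k; exists (- k%:R).
- apply/seteqP; split => // x _; exists (Num.truncn (- x)).+1 => //=.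
  by rewrite in_itv/= andbT ltrNl truncnS_gt.
- move=> _ [c ->]; rewrite /= /distribution /pushforward /=.
  have [c0|c0|->] := ltgtP c 0.
  + by rewrite !tail_neg.
  + exact: tail_pos.
  + have := tail0 _ _ P1 Y mY.
    under eq_fun do rewrite tail_pos//.
    move=> h1; have h2 := tail0 _ _ P2 Z mZ.
    exact: (cvg_unique _ h1 h2).
- by move=> k; rewrite (le_lt_trans (probability_le1 _ _))// ltry.
Qed.

End laplace_uniqueness.

(** * Riemann sums of càdlàg functions *)

Section cadlag.
Context {R : realType}.

Definition cadlag (f : R -> R) :=
  (forall s, 0 <= s -> f @ at_right s --> f s) /\
  (forall s, 0 < s -> cvg (f @ at_left s)).

(** The one-sided limits bound [f] near each point, and compactness of the segment makes the bound
    uniform: the covering filter is that of the bounds [K] tending to infinity. *)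
Lemma cadlag_bounded (f : R -> R) (t : R) : cadlag f ->
  exists K : R, forall s, 0 <= s <= t -> `|f s| <= K.
Proof.
move=> [fr fl].
have /compact_near_coveringP/near_covering_withinP cover :=
  @segment_compact R 0 t.
have : \forall K \near +oo, `[0, t]%classic `<=` [set s | `|f s| <= K].
  apply: cover => x /=; rewrite in_itv/= => /andP[x0 xt].
  have [B leftB] : exists B, \forall s \near x, 0 <= s -> s < x -> `|f s| <= B.
    have [->|xN0] := eqVneq x 0.
      by exists 0; near=> s => s0; rewrite ltNge s0.
    have {}x0 : 0 < x by rewrite lt_neqAle eq_sym xN0.
    have /cvg_ex[l /= /cvgrPdist_le/(_ _ ltr01) fxl] := fl _ x0.
    have {}fxl : \forall s \near x, s < x -> `|l - f s| <= 1 := fxl.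
    exists (`|l| + 1); apply: filterS fxl => s + _ sx => /(_ sx) lf.
    by rewrite -lerBlDl (le_trans (lerB_dist _ _))// distrC.
  have /cvgrPdist_le/(_ _ ltr01) fxr := fr _ x0.
  exists ([set s | (0 <= s -> s < x -> `|f s| <= B) /\
                   (x < s -> `|f x - f s| <= 1)],
          [set K | Num.max (`|f x| + 1) B <= K]) => /=.
    split; last by apply: nbhs_pinfty_ge; exact: num_real.
    by apply: filterI.
  move=> [s K] /= [[sl sr]]; rewrite ge_max in_itv/= => /andP[fK BK] /andP[s0 st].
  have [sx|sx|->] := ltgtP s x.
  - exact: le_trans (sl s0 sx) BK.
  - apply: le_trans fK.
    by rewrite -lerBlDl (le_trans (lerB_dist _ _))// distrC sr.
  - by apply: le_trans fK; rewrite lerDl.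
move=> /filter_ex[K HK]; exists K => s st.
by apply: HK; rewrite /= in_itv.
Unshelve. all: by end_near. Qed.

(** There are [n.+1] cells, so the mesh is meaningful at [n = 0], and the point of index [n.+1] is
    [t]. *)
Definition grid (t : R) (n i : nat) : R := t * i%:R / n.+1%:R.

(** The sum is the integral of a step function whose value at [s] is that of [f] at a grid point
    strictly to the right of [s]. Right continuity gives pointwise convergence, and boundedness of
    [f] gives domination. *)
Lemma riemann_sum_cvg (f : R -> R) (t : R) :
  0 < t -> (forall s, 0 <= f s) -> cadlag f ->
  t / n.+1%:R * \sum_(i < n.+1) f (grid t n i.+1) @[n --> \oo] -->
  Rintegral lebesgue_measure `[0, t] f.
Proof.
move=> t0 f0 cf.
pose I n i : set R := `[grid t n i, grid t n i.+1[%classic.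
pose S n s := \sum_(i < n.+1) f (grid t n i.+1) * \1_(I n i) s.
have mI n i : measurable (I n i) by exact: measurable_itv.
have gridS n i : grid t n i.+1 = grid t n i + t / n.+1%:R.
  by rewrite /grid -natr1; field.
have mS n : measurable_fun setT (S n).
  by apply: measurable_sum => i; exact: measurable_funM.
(* The index of the cell that contains [s]. *)
pose idx n s := Num.truncn (s * n.+1%:R / t).
have idxI n s i : 0 <= s -> s \in I n i = (i == idx n s).
  move=> s0; rewrite eq_sym truncn_eq ?divr_ge0 ?mulr_ge0 ?(ltW t0)//.
  rewrite /I mem_setE in_itv/= /grid.
  by rewrite ler_pdivrMr// ltr_pdivlMr// ler_pdivlMr// ltr_pdivrMr// ![t * _]mulrC.
have SE n s : 0 <= s < t -> S n s = f (grid t n (idx n s).+1).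
  move=> /andP[s0 st].
  have idxn : (idx n s < n.+1)%N.
    rewrite /idx truncn_lt_nat; last by rewrite divr_ge0 ?mulr_ge0 ?(ltW t0).
    by rewrite ltr_pdivrMr// mulrC ltr_pM2l.
  rewrite /S (bigD1 (Ordinal idxn))//= indicE idxI// eqxx mulr1 big1 ?addr0//.
  move=> i; rewrite -val_eqE/= => ii.
  by rewrite indicE idxI// (negbTE ii) mulr0.
have gridgt n s : 0 <= s -> s < grid t n (idx n s).+1.
  move=> s0; have : s \in I n (idx n s) by rewrite idxI.
  by rewrite /I mem_setE in_itv/= => /andP[].
have gridle n s : 0 <= s -> grid t n (idx n s).+1 <= s + t / n.+1%:R.
  move=> s0; have : s \in I n (idx n s) by rewrite idxI.
  by rewrite /I mem_setE in_itv/= => /andP[? _]; rewrite gridS lerD2r.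
have tn0 : t / n.+1%:R @[n --> \oo] --> (0 : R).
  rewrite -[X in _ --> X](mulr0 t); apply: cvgMl_tmp; exact: cvg_harmonic.
have gridcvg s : 0 <= s -> grid t n (idx n s).+1 @[n --> \oo] --> s.
  move=> s0.
  apply: (@squeeze_cvgr _ _ _ _ (cst s) (fun n => s + t / n.+1%:R)).
  - by apply: nearW => n; rewrite gridle// ltW// gridgt.
  - exact: cvg_cst.
  - by rewrite -[X in _ --> X]addr0; apply: cvgD => //; exact: cvg_cst.
have Scvg s : 0 <= s < t -> S n s @[n --> \oo] --> f s.
  move=> s0t; have /andP[s0 st] := s0t.
  under eq_fun do rewrite SE//.
  have /cvg_at_rightP := cf.1 s s0; apply; split => [n|]; first exact: gridgt.
  exact: gridcvg.
have mf : measurable_fun `[0, t[ f.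
  apply: (@measurable_fun_cvg _ _ _ `[0, t[%classic S) => [n|s /=].
  - exact: measurable_funTS.
  - by rewrite in_itv/=; exact: Scvg.
(* The right end of the cell of [s] is at most [s + t / n.+1], hence the crude bound [t + t]. *)
have [K fK] := cadlag_bounded f (t + t) cf.
have [//|||||fint _] := @dominated_convergence _ _ _ lebesgue_measure
  `[0, t[%classic (measurable_itv _) (fun n s => (S n s)%:E) (EFin \o f)
  (cst K%:E)%E.
- by move=> n; apply/measurable_EFinP; apply: measurable_funTS; exact: (mS n).
- exact/measurable_EFinP.
- apply: nearW => s /=; rewrite in_itv/= => st; apply: cvg_EFin.
    exact: nearW.
  exact: Scvg.
- apply: measurable_bounded_integrable => //.
  + by rewrite /= lebesgue_measure_itv/= lte_fin t0 -EFinB ltry.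
  + exact: bounded_cst.
- apply: nearW => s n /=; rewrite in_itv/= => st; rewrite lee_fin SE//.
  have /andP[s0 ts] := st.
  apply: fK; rewrite (le_trans s0) ?(ltW (gridgt _ _ _))//=.
  rewrite (le_trans (gridle _ _ s0))// lerD ?(ltW ts)//.
  by rewrite ler_pdivrMr// ler_peMr ?ler1n// ltW.
(* The cells are half-open and cover only up to [t] excluded; adding that endpoint does not change
   the integral. *)
rewrite integral_itv_bndo_bndc; last exact/measurable_EFinP.
have ffin : (\int[lebesgue_measure]_(x in `[0%R, t]) (f x)%:E)%E \is a fin_num.
  rewrite -integral_itv_bndo_bndc; last exact/measurable_EFinP.
  exact: integrable_fin_num.
rewrite -[X in _ --> X -> _]fineK// => /fine_cvg.
apply: cvg_trans; apply: near_eq_cvg; apply: nearW => n /=.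
under eq_integral do rewrite -sumEFin.
rewrite ge0_integral_sum//; last 2 first.
- move=> i; apply/measurable_EFinP/measurable_funM => //.
  by apply: measurable_indic; exact: mI.
- by move=> i s _; rewrite lee_fin mulr_ge0.
rewrite mulr_sumr -[RHS]/(fine (EFin _)) -sumEFin; congr fine.
apply: eq_bigr => i _.
under eq_integral do rewrite EFinM.
rewrite ge0_integralZl_EFin//; last first.
  by apply/measurable_EFinP; apply: measurable_indic; exact: mI.
rewrite integral_indic//; last exact: mI.
rewrite setIidl.
  rewrite /I /= lebesgue_measure_itv/= lte_fin gridS ltrDl divr_gt0//.
  by rewrite -EFinB addrAC subrr add0r muleC.
move=> s; rewrite /I /= !in_itv/= => /andP[s0 st].
rewrite (le_trans _ s0) ?divr_ge0 ?mulr_ge0 ?(ltW t0)//= (lt_le_trans st)//.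
by rewrite /grid ler_pdivrMr// ler_pM2l// ler_nat.
Qed.
End cadlag.

(** * Laplace transform of the time average of a GCP *)

Section gcp_time_average.
Context {R : realType}.

(* Laplace transform of the uniform law on [0, j], for [j > 0]. *)
Definition unif_laplace (s : R) (j : nat) : R :=
  j%:R^-1 * Rintegral lebesgue_measure `[0, j%:R] (fun x => expR (- (s * x))).

(** The GCP generating function with [u ^ j] replaced by the Laplace transform of the uniform law on
    [0, j]: the common transform of both sides. *)
Definition compound_laplace (k : nat) (lam : nat -> R) (t s : R) : R :=
  expR (t * \sum_(1 <= j < k.+1) lam j * (unif_laplace s j - 1)).

Lemma set_inE (T : Type) (X : T -> R) (B : set R) :
  [set w | X w \in B] = X @^-1` B.
Proof. by apply/seteqP; split => w /=; rewrite inE. Qed.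

Lemma cadlag_continuous (f : R -> R) : continuous f -> cadlag f.
Proof.
move=> cf; split => s _; first exact/cvg_at_right_filter/cf.
by apply/cvg_ex; exists (f s); exact/cvg_at_left_filter/cf.
Qed.

Lemma continuous_expRN (s : R) : continuous (fun x => expR (- (s * x)) : R).
Proof.
move=> x; apply: (@continuous_comp _ _ _ (fun x => - (s * x)) expR).
  by apply: cvgN; apply: cvgMl_tmp; exact: cvg_id.
exact: continuous_expR.
Qed.

(** Abel summation: the [i]-th increment occurs in the [m - i] terms that come after it. *)
Lemma sum_increments (a : nat -> R) (m : nat) : a 0%N = 0 ->
  \sum_(i < m) a i.+1 = \sum_(i < m) (m - i)%:R * (a i.+1 - a i).
Proof.
move=> a0; elim: m => [|m IH]; first by rewrite !big_ord0.
have tel n : a n = \sum_(i < n) (a i.+1 - a i).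
  elim: n => [|n IHn]; first by rewrite big_ord0.
  by rewrite big_ord_recr/= -IHn addrC subrK.
transitivity (\sum_(i < m.+1) (m - i)%:R * (a i.+1 - a i) +
              \sum_(i < m.+1) (a i.+1 - a i)).
  by rewrite -tel big_ord_recr/= IH [in RHS]big_ord_recr/= subnn mul0r addr0.
rewrite -big_split/=; apply: eq_bigr => i _.
by rewrite subSn ?(leq_ord i)// -natr1 mulrDl mul1r.
Qed.

Context (k : nat) (lam : nat -> R) (d : measure_display) (T : measurableType d)
  (P : probability T R) (M : R -> T -> nat) (gcpM : is_GCP P k lam M).

Let mM t : 0 <= t -> measurable_fun setT (proc_R M t).
Proof. by case: gcpM => _ [_ + _ _ _] _; exact. Qed.

Let cM w : cadlag (fun s => proc_R M s w).
Proof.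
by case: gcpM => _ [_ _ [r l] _ _] _; split => s s0; [exact: r|exact: l].
Qed.

(** The generating function at [u = expR (- a)], which lies in [0, 1]. *)
Let gcp_laplace a h : 0 <= a -> 0 <= h ->
  (\int[P]_w (expR (- (a * proc_R M h w)))%:E =
  (expR (h * \sum_(1 <= j < k.+1) lam j * (expR (- (a * j%:R)) - 1)))%:E)%E.
Proof.
move=> a0 h0.
case: gcpM => _ _ /(_ h (expR (- a)) h0).
have -> : -1 <= expR (- a) <= 1.
  by rewrite expR_le1 oppr_le0 a0 andbT (le_trans _ (expR_ge0 _))// oppr_le0.
have E (n : nat) : expR (- (a * n%:R)) = expR (- a) ^+ n.
  by rewrite -expRM_natr mulNr.
move=> /(_ isT) H; under eq_integral do rewrite E.
by rewrite H; under [in RHS]eq_bigr do rewrite E.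
Qed.

Let increment_laplace a u h : 0 <= a -> 0 <= u -> 0 <= h ->
  (\int[P]_w (expR (- (a * (proc_R M (u + h) w - proc_R M u w))))%:E =
  (expR (h * \sum_(1 <= j < k.+1) lam j * (expR (- (a * j%:R)) - 1)))%:E)%E.
Proof.
move=> a0 u0 h0; rewrite -gcp_laplace//.
have mI : measurable_fun setT (fun w => proc_R M (u + h) w - proc_R M u w).
  by apply: measurable_funB; apply: mM => //; exact: addr_ge0.
apply: (@eq_law_integral _ _ _ _ _ _ _ P P
  (fun w => proc_R M (u + h) w - proc_R M u w) (proc_R M h)
  (fun x : R => expR (- (a * x)))) => //.
- exact: mM.
- move=> B mB; case: gcpM => _ [_ _ _ _ /(_ u h B u0 h0 mB) H] _.
  have HE : fine (P ((fun w => proc_R M (u + h) w - proc_R M u w) @^-1` B)) =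
      fine (P (proc_R M h @^-1` B)) by rewrite -!set_inE; exact: H.
  have fin (X : T -> R) : measurable_fun setT X -> P (X @^-1` B) \is a fin_num.
    by move=> mX; rewrite fin_num_measure// -[_ @^-1` _]setTI; exact: mX.
  by rewrite -[LHS]fineK ?fin// HE fineK// fin//; exact: mM.
- by apply: continuous_measurable_fun; exact: continuous_expRN.
Qed.

Definition riemann_avg (t : R) (n : nat) (w : T) : R :=
  n.+1%:R^-1 * \sum_(i < n.+1) proc_R M (grid t n i.+1) w.

Lemma riemann_avg_cvg t w : 0 < t -> riemann_avg t n w @[n --> \oo] --> time_avg M t w.
Proof.
move=> t0.
rewrite /time_avg (_ : (fun n => riemann_avg t n w) = (fun n => t^-1 *
    (t / n.+1%:R * \sum_(i < n.+1) proc_R M (grid t n i.+1) w))); last first.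
  by apply/funext => n; rewrite /riemann_avg !mulrA mulVf ?mul1r// gt_eqF.
apply: cvgMl_tmp.
exact: (@riemann_sum_cvg _ _ t t0 (fun s => ler0n R (M s w)) (cM w)).
Qed.

Let grid_ge0 (t : R) n i : 0 < t -> 0 <= grid t n i.
Proof. by move=> t0; rewrite /grid divr_ge0 ?mulr_ge0 ?(ltW t0). Qed.

Lemma measurable_riemann_avg t n : 0 < t -> measurable_fun setT (riemann_avg t n).
Proof.
move=> t0; apply: measurable_funM => //; apply: measurable_sum => i.
by apply: mM; exact: grid_ge0.
Qed.

Lemma measurable_time_avg t : 0 < t -> measurable_fun setT (time_avg M t).
Proof.
move=> t0; apply: (@measurable_fun_cvg _ _ _ _ (riemann_avg t)).
  by move=> n; exact: measurable_riemann_avg.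
by move=> w _; exact: riemann_avg_cvg.
Qed.

Lemma time_avg_ge0 t w : 0 < t -> 0 <= time_avg M t w.
Proof.
by move=> t0; rewrite mulr_ge0 ?invr_ge0 ?(ltW t0)//; exact: Rintegral_ge0.
Qed.

(** Abel summation reduces the mean to independent increments over steps of length [t / n.+1]; the
    exponents of their transforms add up. *)
Lemma riemann_avg_laplace t n s : 0 < t -> 0 <= s ->
  (\int[P]_w (expR (- (s * riemann_avg t n w)))%:E =
  (expR (t * \sum_(1 <= j < k.+1) lam j *
    (n.+1%:R^-1 * \sum_(i < n.+1) expR (- (s * grid j%:R n i.+1)) - 1)))%:E)%E.
Proof.
move=> t0 s0.
pose D i w := proc_R M (grid t n i.+1) w - proc_R M (grid t n i) w.
(* The coefficient of the increment [D i] in [s] times the Riemann mean. *)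
pose a i : R := s * (n.+1 - i)%:R / n.+1%:R.
pose c i := expR (t / n.+1%:R *
  \sum_(1 <= j < k.+1) lam j * (expR (- (a i * j%:R)) - 1)).
have a0 i : 0 <= a i by rewrite /a divr_ge0 ?mulr_ge0.
have tn0 : 0 <= t / n.+1%:R by rewrite divr_ge0 ?(ltW t0).
have gridS i : grid t n i.+1 = grid t n i + t / n.+1%:R.
  by rewrite /grid -natr1; field.
have mD i : measurable_fun setT (D i).
  by apply: measurable_funB; apply: mM; exact: grid_ge0.
transitivity (\int[P]_w (\prod_(i < n.+1) expR (- (a i * D i w)))%:E)%E.
  apply: eq_integral => w _; rewrite -expR_sum; congr (expR _)%:E.
  rewrite /riemann_avg (sum_increments (fun i => proc_R M (grid t n i) w)).
    rewrite sumrN !mulr_sumr; congr (- _); apply: eq_bigr => i _.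
    by rewrite /a /D; ring.
  rewrite /grid mulr0 mul0r /proc_R.
  by case: gcpM => _ [-> ].
transitivity (\prod_(i < n.+1) c i)%:E.
  apply: (@independent_integral_prod _ _ _ _ _ P n.+1 D
    (fun i x => expR (- (a i * x))) c) => //.
  - move=> B mB; case: gcpM => _ [_ _ _ /(_ n.+1 (grid t n) B) H _] _.
    under eq_bigcapr do rewrite -set_inE.
    under eq_bigr do rewrite -set_inE.
    apply: H => //; first exact: grid_ge0.
    by move=> i; rewrite gridS lerDl.
  - by move=> i; apply: continuous_measurable_fun; exact: continuous_expRN.
  - by move=> i; rewrite /D gridS; apply: increment_laplace => //; exact: grid_ge0.
congr EFin; rewrite -expR_sum; congr expR.
rewrite -mulr_sumr -mulrA; congr (t * _).
rewrite exchange_big/= mulr_sumr; apply: eq_bigr => j _.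
rewrite -mulr_sumr mulrCA; congr (lam j * _).
rewrite sumrB sumr_const card_ord mulrBr -[1 *+ _]/(n.+1%:R) mulVf//.
(* Reversing the order turns the weights [n.+1 - i] into [i.+1], so that [a i * j] becomes [s] times
   a grid point of [0, j]. *)
congr (_ * _ - _); rewrite (reindex_inj rev_ord_inj)/=; apply: eq_bigr => i _.
by rewrite /a /grid subKn//; congr expR; field.
Qed.

(** Both sides of [riemann_avg_laplace] converge: the left by dominated convergence, the right
    because its inner means are Riemann means of an exponential over [0, j]. *)
Lemma time_avg_laplace t s : 0 < t -> 0 <= s ->
  (\int[P]_w (expR (- (s * time_avg M t w)))%:E =
   (compound_laplace k lam t s)%:E)%E.
Proof.
move=> t0 s0.
have [//|||||_ _] := @dominated_convergence _ _ _ P setT measurableT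
  (fun n w => (expR (- (s * riemann_avg t n w)))%:E)
  (fun w => (expR (- (s * time_avg M t w)))%:E) (cst 1)%E.
- by move=> n; apply/measurable_EFinP/measurable_expRN/measurable_riemann_avg.
- exact/measurable_EFinP/measurable_expRN/measurable_time_avg.
- apply: nearW => w _; apply: cvg_EFin; first exact: nearW.
  apply: continuous_cvg; first exact: continuous_expR.
  by apply: cvgN; apply: cvgMl_tmp; exact: riemann_avg_cvg.
- exact: finite_measure_integrable_cst.
- apply: nearW => w n _; rewrite lee_fin ger0_norm ?expR_ge0// expR_le1 oppr_le0.
  by rewrite mulr_ge0// mulr_ge0// sumr_ge0// => i _; exact: ler0n.
move=> H; apply: (cvg_unique _ H) => //; apply: cvg_EFin.
  by apply: nearW => n; rewrite /= riemann_avg_laplace.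
pose e n := t * \sum_(1 <= j < k.+1) lam j *
  (n.+1%:R^-1 * \sum_(i < n.+1) expR (- (s * grid j%:R n i.+1)) - 1).
rewrite (_ : fine \o _ = expR \o e); last first.
  by apply/funext => n; rewrite /= riemann_avg_laplace.
suff ecvg : e @ \oo --> t * \sum_(1 <= j < k.+1) lam j * (unif_laplace s j - 1).
  rewrite /compound_laplace.
  by apply: (cvg_comp _ _ ecvg); exact: continuous_expR.
(* Shifting the index writes jump sizes as [j.+1], which makes the interval length visibly
   positive. *)
apply: cvgMl_tmp; rewrite big_add1/=; under eq_fun do rewrite big_add1/=.
apply: cvg_big => [|j _]; first exact: add_continuous.
apply: cvgMl_tmp; apply: cvgB; last exact: cvg_cst.
have j0 : (0 : R) < j.+1%:R by [].
rewrite (_ : (fun n => _) = (fun n => j.+1%:R^-1 * (j.+1%:R / n.+1%:R *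
    \sum_(i < n.+1) expR (- (s * grid j.+1%:R n i.+1))))); last first.
  by apply/funext => n; rewrite !mulrA mulVf ?mul1r// gt_eqF.
apply: cvgMl_tmp.
apply: (riemann_sum_cvg _ _ j0 (fun x => expR_ge0 (- (s * x)))).
by apply: cadlag_continuous; exact: continuous_expRN.
Qed.

End gcp_time_average.

(** * Laplace transform of a random sum *)

Section compound_sum.
Context {R : realType} (d : measure_display) (T : measurableType d)
  (P : probability T R) (N : T -> nat) (X : nat -> T -> R).
Hypothesis mN : measurable_fun setT (fun w => (N w)%:R : R).
Hypothesis mX : forall i, measurable_fun setT (X i).
Hypothesis indep : forall (n : nat) (A : set R) (B : nat -> set R),
  measurable A -> (forall i, measurable (B i)) ->
  fine (P ((fun w => (N w)%:R : R) @^-1` A `&`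
           \bigcap_(i in `I_n) (X i @^-1` B i))) =
  fine (P ((fun w => (N w)%:R : R) @^-1` A)) *
  \prod_(i < n) fine (P (X i @^-1` B i)).

Let F n := (fun w => (N w)%:R : R) @^-1` [set n%:R].

Let FE n w : F n w <-> N w = n.
Proof.
by rewrite /F/=; split => [/eqP|->//]; rewrite eqr_nat => /eqP.
Qed.

Let mF n : measurable (F n).
Proof. by rewrite /F -[_ @^-1` _]setTI; exact: mN. Qed.

Let trivF : trivIset setT F.
Proof. by move=> i j _ _ [w [/FE <- /FE <-]]. Qed.

Let coverF : \bigcup_n F n = setT.
Proof. by apply/seteqP; split => // w _; exists (N w) => //; exact/FE. Qed.

Lemma measurable_random_sum : measurable_fun setT (fun w => \sum_(i < N w) X i w).
Proof.
move=> _ B mB; rewrite setTI.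
rewrite (_ : _ @^-1` B = \bigcup_n (F n `&` (fun w => \sum_(i < n) X i w) @^-1` B)).
  apply: bigcup_measurable => n _; apply: measurableI => //.
  by rewrite -[_ @^-1` _]setTI; apply: measurable_sum.
apply/seteqP; split => w /=.
  by move=> Bw; exists (N w) => //; split => //; exact/FE.
by move=> [n _ [/FE <-]].
Qed.

Lemma random_sum_ge0 : (forall i, {ae P, forall w, 0 <= X i w}) ->
  {ae P, forall w, 0 <= \sum_(i < N w) X i w}.
Proof.
move=> X0; have : {ae P, forall w i, 0 <= X i w} by exact/ae_foralln.
by apply: filterS => w Xw; exact: sumr_ge0.
Qed.

(** Both integrals are split over the events [F n]. On each of them the sum has [n] terms, and
    independence makes either piece equal to [P (F n)] times [phi ^+ n]. *)
Lemma random_sum_laplace (s phi : R) : 0 <= phi ->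
  (forall i, (\int[P]_w (expR (- (s * X i w)))%:E = phi%:E)%E) ->
  (\int[P]_w (expR (- (s * \sum_(i < N w) X i w)))%:E =
   \int[P]_w (phi ^+ N w)%:E)%E.
Proof.
move=> phi0 Xphi.
have mphi : measurable_fun setT (fun w => phi ^+ N w).
  move=> _ B mB; rewrite setTI.
  rewrite (_ : _ @^-1` B = \bigcup_n (F n `&` (if phi ^+ n \in B then setT else set0))).
    by apply: bigcup_measurable => n _; apply: measurableI => //; case: ifPn.
  apply/seteqP; split => w /=.
    by move=> Bw; exists (N w) => //; split; [exact/FE|rewrite mem_set].
  by move=> [n _ [/FE <-]]; case: ifPn => //; rewrite inE.
rewrite -coverF ge0_integral_bigcup//; last first.
  rewrite coverF; apply/measurable_EFinP/measurable_expRN.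
  exact: measurable_random_sum.
rewrite ge0_integral_bigcup//; first last.
- by move=> w _; rewrite lee_fin exprn_ge0.
- by rewrite coverF; exact/measurable_EFinP.
apply: eq_eseriesr => n _.
have PF : (\int[P]_w (\1_(F n) w)%:E = (fine (P (F n)))%:E)%E.
  by rewrite integral_indic// setIT fineK// fin_num_measure.
transitivity (fine (P (F n)) * phi ^+ n)%:E; last first.
  transitivity (\int[P]_(w in F n) (phi ^+ n)%:E)%E.
    by rewrite integral_cst// muleC EFinM fineK// fin_num_measure.
  by apply: eq_integral => w; rewrite inE => /FE ->.
(* The count becomes coordinate 0, with the indicator of the value [n] as its function, so
   [independent_integral_prod] treats it along with the summands. *)
pose X' i := if i is i'.+1 then X i' else (fun w => (N w)%:R : R).
pose h i : R -> R := if i is _.+1 then (fun x => expR (- (s * x))) else \1_[set n%:R].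
pose c i := if i is _.+1 then phi else fine (P (F n)).
transitivity (\int[P]_w (\prod_(i < n.+1) h i (X' i w))%:E)%E.
  rewrite integral_mkcond; apply: eq_integral => w _.
  rewrite big_ord_recl/= /patch indicE.
  have -> : ((N w)%:R \in [set n%:R : R]) = (w \in F n) by [].
  case: ifPn => [|_]; last by rewrite mul0r.
  rewrite inE => /FE ->; rewrite mul1r -expR_sum mulr_sumr sumrN.
  by [].
rewrite (@independent_integral_prod _ _ _ _ _ P n.+1 X' h c).
- by rewrite big_ord_recl/= prodr_const card_ord.
- by case.
- move=> B mB; rewrite [in RHS]big_ord_recl.
  rewrite -[RHS](indep n (B 0%N) (fun i => B i.+1))//.
  congr (fine (P _)); apply/seteqP; split => w /=.
    move=> H; split; first exact: (H 0%N).
    by move=> i /= ilt; exact: (H i.+1).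
  by move=> [H0 H] [|i] //= ilt; exact: H.
- case => [|i]/=; first exact: measurable_indic.
  by apply: continuous_measurable_fun; exact: continuous_expRN.
- by case => [|i] y //=; exact: expR_ge0.
- by case => [|i] /=; [exact: PF|exact: Xphi].
Qed.

End compound_sum.

(** * The mixture of uniform laws *)

Section uniform_mixture.
Context {R : realType} (k : nat) (lam : nat -> R).
Let Lam := \sum_(1 <= j < k.+1) lam j.
Hypothesis lam0 : forall j, (1 <= j <= k)%N -> 0 <= lam j.
Hypothesis Lam0 : 0 < Lam.

Definition mix_weight (j : nat) : R := (lam j / Lam) * j%:R^-1.

Let mix_weight_ge0 j : (1 <= j < k.+1)%N -> 0 <= mix_weight j.
Proof. by move=> jk; rewrite /mix_weight !mulr_ge0 ?invr_ge0 ?(ltW Lam0) ?lam0. Qed.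

Lemma mix_densityE x :
  mix_density k lam x = \sum_(1 <= j < k.+1) mix_weight j * \1_`[0, j%:R] x.
Proof.
apply: eq_bigr => j _; congr (_ * _).
by rewrite indicE mem_setE in_itv/=; case: ifPn.
Qed.

Lemma mix_density_ge0 x : 0 <= mix_density k lam x.
Proof.
rewrite mix_densityE big_nat_cond sumr_ge0// => j; rewrite andbT => jk.
by rewrite mulr_ge0// mix_weight_ge0.
Qed.

Lemma mix_density_lt0 x : x < 0 -> mix_density k lam x = 0.
Proof.
move=> x0; rewrite mix_densityE big1// => j _.
by rewrite indicE mem_setE in_itv/= leNgt x0 mulr0.
Qed.

Lemma measurable_mix_density : measurable_fun setT (mix_density k lam).
Proof.
rewrite (_ : mix_density k lam =
    (fun x => \sum_(1 <= j < k.+1) mix_weight j * \1_`[0, j%:R] x)).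
  by apply: measurable_sum => j; exact: measurable_funM.
by apply/funext => x; exact: mix_densityE.
Qed.

Lemma mix_density_laplace (s : R) :
  (\int[lebesgue_measure]_x (mix_density k lam x * expR (- (s * x)))%:E =
   (Lam^-1 * \sum_(1 <= j < k.+1) lam j * unif_laplace s j)%:E)%E.
Proof.
pose g j x := mix_weight j * \1_`[0, j%:R] x * expR (- (s * x)).
have mE : measurable_fun setT (fun x : R => expR (- (s * x))).
  by apply: continuous_measurable_fun; exact: continuous_expRN.
(* The guard makes every term nonnegative for all [j], whereas the sign of [lam j] is known only for
   [j] from 1 to [k]. *)
transitivity (\int[lebesgue_measure]_x \sum_(j <- index_iota 1 k.+1 | true)
    (if (1 <= j < k.+1)%N then g j x else 0)%:E)%E.
  apply: eq_integral => x _; rewrite sumEFin; congr EFin.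
  rewrite mix_densityE mulr_suml; apply: eq_big_nat => j jk.
  by rewrite jk.
rewrite ge0_integral_sum//; last 2 first.
- move=> j; apply/measurable_EFinP; case: (_ <= _ < _)%N => //.
  apply: measurable_funM => //; apply: measurable_funM => //.
- move=> j x _; rewrite lee_fin; case: ifPn => // jk.
  by rewrite mulr_ge0 ?expR_ge0// mulr_ge0// mix_weight_ge0.
rewrite mulr_sumr -sumEFin; apply: eq_big_nat => j jk; rewrite jk.
transitivity ((mix_weight j)%:E *
    \int[lebesgue_measure]_(x in `[0%R, j%:R]) (expR (- (s * x)))%:E)%E.
  rewrite [in RHS]integral_mkcond -ge0_integralZl_EFin ?mix_weight_ge0//;
    last 2 first.
  - by move=> x _; rewrite /patch; case: ifPn => // _; rewrite lee_fin expR_ge0.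
  - apply: (measurable_restrictT _ _).1; first exact: measurable_itv.
    by apply/measurable_EFinP/measurable_funTS; exact: mE.
  apply: eq_integral => x _; rewrite /patch /g -mulrA EFinM; congr (_ * _)%E.
  by rewrite indicE; case: ifPn => _; rewrite ?mul1r ?mul0r.
have fin : (\int[lebesgue_measure]_(x in `[0%R, j%:R])
    (expR (- (s * x)))%:E)%E \is a fin_num.
  apply: integrable_fin_num => //; apply: continuous_compact_integrable.
    exact: segment_compact.
  by apply: continuous_subspaceT; exact: continuous_expRN.
rewrite -(fineK fin) -EFinM; congr EFin.
by rewrite /mix_weight /unif_laplace /Rintegral; ring.
Qed.

Context (d : measure_display) (T : measurableType d) (P : probability T R)
  (X : T -> R).
Hypothesis mX : measurable_fun setT X.
Hypothesis dX : forall B, measurable B ->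
  (P (X @^-1` B) = \int[lebesgue_measure]_(x in B) (mix_density k lam x)%:E)%E.

Lemma mixture_ge0 : {ae P, forall w, 0 <= X w}.
Proof.
exists (X @^-1` `]-oo, 0[); split.
- by rewrite -[_ @^-1` _]setTI; exact: mX.
- rewrite dX// integral0_eq// => x /=; rewrite in_itv/= => x0.
  by rewrite mix_density_lt0.
- by move=> w /= /negP; rewrite in_itv/= -ltNge.
Qed.

(** The law of [X] is compared with Lebesgue measure weighted by the density, the identity map
    playing the second variable. *)
Lemma mixture_laplace (s : R) :
  (\int[P]_w (expR (- (s * X w)))%:E =
   (Lam^-1 * \sum_(1 <= j < k.+1) lam j * unif_laplace s j)%:E)%E.
Proof.
rewrite -mix_density_laplace.
transitivity (\int[P]_w (1 * expR (- (s * X w)))%:E)%E.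
  by apply: eq_integral => w _; rewrite mul1r.
apply: (@eq_weighted_law_integral _ _ _ _ _ _ _ P lebesgue_measure (cst 1)
  (mix_density k lam) X (fun x => x) (fun x : R => expR (- (s * x)))) => //.
- exact: measurable_mix_density.
- exact: mix_density_ge0.
- move=> B mB.
  transitivity (P (X @^-1` B)).
    rewrite -[X @^-1` B]setIT -integral_indic//; last first.
      by rewrite -[_ @^-1` _]setTI; exact: mX.
    by apply: eq_integral => w _; rewrite mul1r.
  rewrite dX// [LHS]integral_mkcond; apply: eq_integral => x _.
  by rewrite /patch indicE; case: ifPn => _; rewrite ?mulr1 ?mulr0.
- by apply: continuous_measurable_fun; exact: continuous_expRN.
Qed.

End uniform_mixture.

(** * Comparison of the two transforms *)

Theorem theorem7p2 (R : realType)
  (k : nat) (lam : nat -> R)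
  (d1 : measure_display) (T1 : measurableType d1) (P1 : probability T1 R)
  (M : R -> T1 -> nat)
  (d2 : measure_display) (T2 : measurableType d2) (P2 : probability T2 R)
  (N : R -> T2 -> nat) (X : nat -> T2 -> R) :
  is_GCP P1 k lam M ->
  0 < \sum_(1 <= j < k.+1) lam j ->
  is_poisson_process P2 (\sum_(1 <= j < k.+1) lam j) N ->
  (* each X_i is a random variable with density mix_density k lam *)
  (forall i, measurable_fun setT (X i)) ->
  (forall i (B : set R), measurable B ->
     P2 [set w | X i w \in B] =
     (\int[lebesgue_measure]_(x in B) (mix_density k lam x)%:E)%E) ->
  (* X_0, X_1, ... are mutually independent and independent of the process N *)
  (forall (m n : nat) (ts : nat -> R) (A : nat -> set R) (B : nat -> set R),
     (forall j, 0 <= ts j) ->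
     (forall j, measurable (A j)) -> (forall i, measurable (B i)) ->
     prob P2 ((\bigcap_(j in `I_m) [set w | proc_R N (ts j) w \in A j])
              `&` (\bigcap_(i in `I_n) [set w | X i w \in B i]))
     = prob P2 (\bigcap_(j in `I_m) [set w | proc_R N (ts j) w \in A j])
       * \prod_(i < n) prob P2 [set w | X i w \in B i]) ->
  forall t, 0 < t ->
  forall B : set R, measurable B ->
    P1 [set w | time_avg M t w \in B] =
    P2 [set w | \sum_(i < N t w) X i w \in B].
Proof.
move=> gcpM Lam0 poisN mX dX indep t t0 B mB.
set Lam := \sum_(1 <= j < k.+1) lam j in Lam0 poisN.
have lam0 : forall j, (1 <= j <= k)%N -> 0 <= lam j by case: gcpM.
have mN : measurable_fun setT (fun w => (N t w)%:R : R).
  by case: poisN => _ [_ /(_ t (ltW t0))].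
have dX' i A : measurable A -> (P2 (X i @^-1` A) =
    \int[lebesgue_measure]_(x in A) (mix_density k lam x)%:E)%E.
  by move=> mA; rewrite -(dX i)// set_inE.
have X0 i : {ae P2, forall w, 0 <= X i w}.
  exact: (mixture_ge0 _ _ _ _ _ _ (mX i) (dX' i)).
have indep' (n : nat) (A : set R) (C : nat -> set R) :
    measurable A -> (forall i, measurable (C i)) ->
    fine (P2 ((fun w => (N t w)%:R : R) @^-1` A `&`
             \bigcap_(i in `I_n) (X i @^-1` C i))) =
    fine (P2 ((fun w => (N t w)%:R : R) @^-1` A)) *
    \prod_(i < n) fine (P2 (X i @^-1` C i)).
  move=> mA mC.
  (* Independence from the whole process is specialised to the single time [t]. *)
  have := indep 1%N n (fun=> t) (fun=> A) C (fun=> ltW t0) (fun=> mA) mC.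
  have -> : \bigcap_(j in `I_1) [set w | proc_R N t w \in A] =
      (fun w => (N t w)%:R : R) @^-1` A.
    apply/seteqP; split => w /=; first by move=> /(_ 0%N isT) /=; rewrite inE.
    by move=> Aw i _ /=; rewrite inE.
  rewrite /prob; under eq_bigcapr do rewrite set_inE.
  by under eq_bigr do rewrite set_inE.
have -> : [set w | time_avg M t w \in B] = time_avg M t @^-1` B by exact: set_inE.
rewrite (set_inE _ (fun w => \sum_(i < N t w) X i w)).
apply: (@eq_laplace_law _ _ _ _ _ _ _ _ _ (compound_laplace k lam t)) => //.
- exact: measurable_time_avg gcpM _ t0.
- exact: measurable_random_sum.
- by apply: nearW => w; exact: time_avg_ge0.
- exact: random_sum_ge0.
- by move=> s s0; exact: time_avg_laplace.
- move=> s s0.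
  set phi := Lam^-1 * \sum_(1 <= j < k.+1) lam j * unif_laplace s j.
  have Xphi i : (\int[P2]_w (expR (- (s * X i w)))%:E = phi%:E)%E.
    exact: (mixture_laplace _ _ lam0 Lam0 _ _ _ _ (mX i) (dX' i)).
  have phi0 : 0 <= phi.
    by rewrite -lee_fin -(Xphi 0%N) integral_ge0// => w _; rewrite lee_fin expR_ge0.
  (* With [phi] in [0, 1], the generating function of [N t] may be evaluated at [phi]. *)
  have phi1 : phi <= 1.
    rewrite -lee_fin -(Xphi 0%N) -(@probability_setT _ _ _ P2) -[leRHS]mul1e.
    rewrite -integral_cst//; apply: ae_ge0_le_integral => //.
    + by apply/measurable_EFinP; exact: measurable_expRN.
    + apply: filterS (X0 0%N) => w Xw _.
      by rewrite lee_fin expR_le1 oppr_le0 mulr_ge0.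
  rewrite (random_sum_laplace _ _ _ _ _ mN mX indep' s phi phi0 Xphi).
  case: poisN => _ _ ->; [|exact: ltW|]; last first.
    by rewrite phi1 (le_trans _ phi0)// oppr_le0.
  (* The Poisson exponent has the single term [Lam * (phi - 1)]; [Lam] cancels the normalisation
     inside [phi] and equals the sum of the rates. *)
  congr (expR (t * _))%:E; rewrite big_nat1 expr1.
  under [in RHS]eq_bigr do rewrite mulrBr mulr1.
  by rewrite sumrB -/Lam mulrBr mulr1 /phi mulrA divff ?mul1r// gt_eqF.
Qed.
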